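(* Let $f$ be a graph convolutional network with $M$ graph convolution layers and output $f(X,A)\in\mathbb{R}^{n\times c}$. Let $e_v\in\mathbb{R}^n$ be the indicator vector of the target node, let $y\in\{1,\dots,c\}$ be the target class, and let $F(X,A)=\{e_v^\top f(X,A)\}_y\in\mathbb{R}$. Fix an input graph $(X,A)$ and perturbation distributions $\mathcal{D}_X$ on $\mathbb{R}^{n\times d}$ and $\mathcal{D}_A$ on $\mathbb{R}^{n\times n}$. Let $p$ be a KEC model for $F$, $$p(X,A)=\sum_{k=1}^{M}e_v^\top N(A^k)Xw_k,\qquad w_1,\dots,w_M\in\mathbb{R}^d,$$ with parameter vector $W=[w_1^\top,w_2^\top,\dots,w_M^\top]^\top\in\mathbb{R}^{Md}$. For $\epsilon_X\sim\mathcal{D}_X$, $\epsilon_A\sim\mathcal{D}_A$, define $$\tau_k=\big(e_v^\top[N(A^k)X-N((A-\epsilon_A)^k)(X-\epsilon_X)]\big)^\top\in\mathbb{R}^d\quad(k=1,\dots,M),\qquad \phi=[\tau_1^\top,\dots,\tau_M^\top]^\top\in\mathbb{R}^{Md},$$ $$\delta(f)=f_y(X,A)-f_y(X-\epsilon_X,A-\epsilon_A)\in\mathbb{R}^n,$$ where $f_y$ denotes the $y$-th column of $f$. If the matrix $\mathbb{E}_{\epsilon_X,\epsilon_A}[\phi\phi^\top]$ is invertible, then the parameter vector $W$ that minimizes the general unfaithfulness $\Delta(p)$ is $$W^*=\big(\mathbb{E}_{\epsilon_X,\epsilon_A}[\phi\phi^\top]\big)^{-1}\,\mathbb{E}_{\epsilon_X,\epsilon_A}\big[\phi\cdot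 e_v^\top\delta(f)\big].$$
   Context: A graph is a pair $(X,A)$ with node feature matrix $X\in\mathbb{R}^{n\times d}$ ($n$ nodes, $d$ features) and weighted adjacency matrix $A\in\mathbb{R}^{n\times n}$ with nonnegative entries; perturbed adjacency matrices $A-\epsilon_A$ also have nonnegative entries. For a nonnegative matrix $B\in\mathbb{R}^{n\times n}$, $N(B)=D^{-1/2}(B+I)D^{-1/2}$, where $D$ is the degree matrix, i.e. the diagonal matrix of row sums of $B+I$. $A^k$ is the $k$-th matrix power. A graph convolutional network $f$ is a stack of graph convolution layers $X\mapsto N(A)XW'$ ($W'$ a weight matrix) and dense layers, separated by ReLU activations. KEC model ($k$-hop model with a convolutional core): if $F$ has $M$ graph convolution layers, it is the function $p(X,A)=\sum_{k=1}^M e_v^\top N(A^k)Xw_k$ with trainable parameters $w_1,\dots,w_M\in\mathbb{R}^d$. General unfaithfulness: for a function $p$, an input $(X,A)$, and distributions $\mathcal{D}_X,\mathcal{D}_A$, $$\Delta(p)=\mathbb{E}_{\epsilon_X\sim\mathcal{D}_X,\ \epsilon_A\sim\mathcal{D}_A}\Big[p(X,A)-p(X-\epsilon_X,A-\epsilon_A)-\big(F(X,A)-F(X-\epsilon_X,A-\epsilon_A)\big)\Big]^2 ,$$ that is, the expectation of the square of the bracket. All the expectations appearing (in particular the second moments of $\phi$ and of $e_v^\top\delta(f)$) are assumed to exist and be finite. *)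

(* Defs.v *)
From mathcomp Require Import all_boot all_order all_algebra.
From mathcomp Require Import all_classical all_reals all_analysis.

Set Implicit Arguments.
Unset Strict Implicit.
Unset Printing Implicit Defensive.

Import Order.TTheory GRing.Theory Num.Theory.
Import numFieldNormedType.Exports.

Local Open Scope classical_set_scope.
Local Open Scope ring_scope.

Definition nonneg_mx (R : realType) (m n : nat) (B : 'M[R]_(m, n)) : Prop :=
  forall i j, 0 <= B i j.

Definition degree_mx (R : realType) (n : nat) (B : 'M[R]_n) : 'rV[R]_n :=
  \row_i \sum_j (B + 1%:M) i j.

(* For B nonnegative the row sums of B + I are at least 1, so neither the square
   root nor the inverse takes its default value. *)
Definition normalize_mx (R : realType) (n : nat) (B : 'M[R]_n) : 'M[R]_n :=
  let Dm12 := diag_mx (map_mx (fun t => (Num.sqrt t)^-1) (degree_mx B)) in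
  Dm12 *m (B + 1%:M) *m Dm12.

Definition relu (R : realType) (m n : nat) (X : 'M[R]_(m, n)) : 'M[R]_(m, n) :=
  map_mx (Num.max 0) X.

(* A dense layer acts as X |-> X V + 1 b, the same bias row b being added at
   every node; b = 0 gives the bias-free layer. *)
Inductive layer (R : realType) (d c : nat) : Type :=
| GraphConv of 'M[R]_(d, c)
| Dense of 'M[R]_(d, c) & 'rV[R]_c.

Definition layer_eval (R : realType) (n d c : nat) (l : layer R d c)
    (X : 'M[R]_(n, d)) (A : 'M[R]_n) : 'M[R]_(n, c) :=
  match l with
  | GraphConv V => normalize_mx A *m X *m V
  | Dense V b => X *m V + const_mx 1 *m b
  end.

Definition is_conv (R : realType) (d c : nat) (l : layer R d c) : bool :=
  if l is GraphConv _ then true else false.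

(* A nonempty stack of layers, the first one applied first. *)
Inductive gcn (R : realType) : nat -> nat -> Type :=
| LastLayer d c of layer R d c : gcn R d c
| ConsLayer d h c of layer R d h & gcn R h c : gcn R d c.

Fixpoint gcn_eval (R : realType) (n d c : nat) (f : gcn R d c) :
    'M[R]_(n, d) -> 'M[R]_n -> 'M[R]_(n, c) :=
  match f with
  | LastLayer _ _ l => fun X A => layer_eval l X A
  | ConsLayer _ _ _ l g => fun X A => gcn_eval g (relu (layer_eval l X A)) A
  end.

Fixpoint conv_count (R : realType) (d c : nat) (f : gcn R d c) : nat :=
  match f with
  | LastLayer _ _ l => is_conv l
  | ConsLayer _ _ _ l g => (is_conv l + conv_count g)%N
  end.

Definition node_indic (R : realType) (n : nat) (v : 'I_n) : 'cV[R]_n :=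
  delta_mx v 0.

Definition target (R : realType) (n d c : nat) (f : gcn R d c) (v : 'I_n)
    (y : 'I_c) (X : 'M[R]_(n, d)) (A : 'M[R]_n) : R :=
  ((node_indic R v)^T *m gcn_eval f X A) 0 y.

(* R^(Md), as M stacked blocks of height d *)
Notation stacked R M d := 'cV[R]_(\sum_(k < M) d).

Definition block (R : realType) (M d : nat) (W : stacked R M d) (k : 'I_M) :
    'cV[R]_d :=
  @submxcol R M (fun=> d) 1 W k.

(* The ordinal k : 'I_M stands for the hop k.+1. *)
Definition kec (R : realType) (n d M : nat) (v : 'I_n) (W : stacked R M d)
    (X : 'M[R]_(n, d)) (A : 'M[R]_n) : R :=
  \sum_(k < M)
    ((node_indic R v)^T *m normalize_mx (A ^+ k.+1) *m X *m block W k) 0 0.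

Definition tau (R : realType) (n d : nat) (v : 'I_n) (k : nat)
    (X : 'M[R]_(n, d)) (A : 'M[R]_n) (eX : 'M[R]_(n, d)) (eA : 'M[R]_n) :
    'cV[R]_d :=
  ((node_indic R v)^T *m (normalize_mx (A ^+ k) *m X
                     - normalize_mx ((A - eA) ^+ k) *m (X - eX)))^T.

Definition phi (R : realType) (n d M : nat) (v : 'I_n)
    (X : 'M[R]_(n, d)) (A : 'M[R]_n) (eX : 'M[R]_(n, d)) (eA : 'M[R]_n) :
    stacked R M d :=
  \mxcol_(k < M) tau v k.+1 X A eX eA.

Definition delta (R : realType) (n d c : nat) (f : gcn R d c) (y : 'I_c)
    (X : 'M[R]_(n, d)) (A : 'M[R]_n) (eX : 'M[R]_(n, d)) (eA : 'M[R]_n) :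
    'cV[R]_n :=
  col y (gcn_eval f X A) - col y (gcn_eval f (X - eX) (A - eA)).

Definition borel_mx (R : realType) (m n : nat) : measurableType _ :=
  g_sigma_algebraType (@open 'M[R]_(m, n)).

Definition integrable_mx (dT : measure_display) (T : measurableType dT)
    (R : realType) (P : probability T R) (m n : nat) (Z : T -> 'M[R]_(m, n)) :
    Prop :=
  forall i j, P.-integrable setT (fun t => (Z t i j)%:E).

Definition expectation_mx (dT : measure_display) (T : measurableType dT)
    (R : realType) (P : probability T R) (m n : nat) (Z : T -> 'M[R]_(m, n)) :
    'M[R]_(m, n) :=
  \matrix_(i, j) fine 'E_P[fun t => Z t i j].

Definition unfaithfulness (dT : measure_display) (T : measurableType dT)
    (R : realType) (P : probability T R) (n d : nat)
    (F p : 'M[R]_(n, d) -> 'M[R]_n -> R) (X : 'M[R]_(n, d)) (A : 'M[R]_n)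
    (eX : T -> 'M[R]_(n, d)) (eA : T -> 'M[R]_n) : \bar R :=
  'E_P[fun t => (p X A - p (X - eX t) (A - eA t)
                 - (F X A - F (X - eX t) (A - eA t))) ^+ 2].

(* Main.v *)
(* Since the bracket in the unfaithfulness equals W^T phi - e_v^T delta, the
   unfaithfulness is the quadratic W^T S W - 2 W^T b + const with S = E[phi phi^T]
   positive semidefinite and b = E[phi e_v^T delta].  Expanding around W, the
   increment along g is g^T S g + 2 g^T (S W - b), so W is a minimizer iff the
   normal equation S W = b holds. *)
Require Import Defs.
From mathcomp Require Import all_boot all_order all_algebra.
From mathcomp Require Import all_classical all_reals all_analysis.
From mathcomp Require Import ring.

Set Implicit Arguments.
Unset Strict Implicit.
Unset Printing Implicit Defensive.

Import Order.TTheory GRing.Theory Num.Theory.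
Import numFieldNormedType.Exports.

Local Open Scope classical_set_scope.
Local Open Scope ring_scope.

(** Scalars are kept as 1x1 matrices; since these equal their transposes, a product can be reversed
    for free. *)
Lemma trmx11 (V : Type) (B : 'M[V]_1) : B^T = B.
Proof. by apply/matrixP => i j; rewrite mxE !ord1. Qed.

Lemma sqr_mx11 (R : pzSemiRingType) (B : 'M[R]_1) :
  B 0 0 ^+ 2 = (B *m B^T) 0 0.
Proof. by rewrite trmx11 mxE big_ord1 expr2. Qed.

Lemma mulmx_tr_cVC (R : comPzSemiRingType) m (g h : 'cV[R]_m) :
  g^T *m h = h^T *m g.
Proof. by rewrite -[LHS]trmx11 trmx_mul trmxK. Qed.

Section expectation_mx.
Context (dT : measure_display) (T : measurableType dT) (R : realType).
Variable P : probability T R.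

Lemma expectation_mxE m n (Z : T -> 'M[R]_(m, n)) i j :
  expectation_mx P Z i j = (\int[P]_t Z t i j)%R.
Proof. by rewrite mxE unlock. Qed.

Lemma integrable_mx_tr m n (Z : T -> 'M[R]_(m, n)) :
  integrable_mx P Z -> integrable_mx P (fun t => (Z t)^T).
Proof. by move=> iZ i j; under eq_fun do rewrite mxE; exact: iZ. Qed.

Lemma expectation_mx_tr m n (Z : T -> 'M[R]_(m, n)) :
  expectation_mx P (fun t => (Z t)^T) = (expectation_mx P Z)^T.
Proof.
apply/matrixP => i j; rewrite [RHS]mxE !expectation_mxE.
by congr Rintegral; apply/funext => t; rewrite mxE.
Qed.

Lemma integrable_mxD m n (Y Z : T -> 'M[R]_(m, n)) :
  integrable_mx P Y -> integrable_mx P Z ->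
  integrable_mx P (fun t => Y t + Z t).
Proof.
move=> iY iZ i j; under eq_fun do rewrite mxE EFinD.
exact: integrableD.
Qed.

Lemma expectation_mxD m n (Y Z : T -> 'M[R]_(m, n)) :
  integrable_mx P Y -> integrable_mx P Z ->
  expectation_mx P (fun t => Y t + Z t) =
  expectation_mx P Y + expectation_mx P Z.
Proof.
move=> iY iZ; apply/matrixP => i j; rewrite [RHS]mxE !expectation_mxE.
transitivity (\int[P]_t (Y t i j + Z t i j))%R.
  by congr Rintegral; apply/funext => t; rewrite mxE.
exact: (RintegralD measurableT (iY i j) (iZ i j)).
Qed.

Lemma integrable_mxMl m n p (L : 'M[R]_(m, n)) (Z : T -> 'M[R]_(n, p)) :
  integrable_mx P Z -> integrable_mx P (fun t => L *m Z t).
Proof.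
move=> iZ i j; under eq_fun do rewrite mxE -sumEFin.
apply: integrable_sum => // k _; under eq_fun do rewrite EFinM.
by apply: integrableZl => //; exact: iZ.
Qed.

Lemma expectation_mxMl m n p (L : 'M[R]_(m, n)) (Z : T -> 'M[R]_(n, p)) :
  integrable_mx P Z ->
  expectation_mx P (fun t => L *m Z t) = L *m expectation_mx P Z.
Proof.
move=> iZ; apply/matrixP => i j; rewrite expectation_mxE mxE.
have iLZ k : P.-integrable setT (fun t => (L i k * Z t k j)%:E).
  by under eq_fun do rewrite EFinM; apply: integrableZl => //; exact: iZ.
rewrite /Rintegral; under eq_integral do rewrite mxE -sumEFin.
(* [fine] commutes with a sum of finite terms only, hence the side goal. *)
rewrite integral_sum// -sum_fine => [|k _]; last exact: integrable_fin_num.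
apply: eq_bigr => k _; rewrite expectation_mxE.
by apply: RintegralZl => //; exact: iZ.
Qed.

Lemma integrable_mxMr m n p (L : 'M[R]_(n, p)) (Z : T -> 'M[R]_(m, n)) :
  integrable_mx P Z -> integrable_mx P (fun t => Z t *m L).
Proof.
move=> /integrable_mx_tr/(integrable_mxMl L^T)/integrable_mx_tr.
by under eq_fun do rewrite trmx_mul !trmxK.
Qed.

Lemma expectation_mxMr m n p (L : 'M[R]_(n, p)) (Z : T -> 'M[R]_(m, n)) :
  integrable_mx P Z ->
  expectation_mx P (fun t => Z t *m L) = expectation_mx P Z *m L.
Proof.
move=> iZ; apply: trmx_inj; rewrite -expectation_mx_tr trmx_mul.
under eq_fun do rewrite trmx_mul.
by rewrite expectation_mxMl ?expectation_mx_tr//; exact: integrable_mx_tr.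
Qed.

(** Integrability makes the extended-real expectation finite, so the [fine] inside [expectation_mx]
    loses nothing. *)
Lemma expectation_mx11 (Z : T -> 'M[R]_1) :
  integrable_mx P Z ->
  ('E_P[(fun t => Z t 0 0)%R])%E = (expectation_mx P Z 0 0)%:E.
Proof.
by move=> iZ; rewrite mxE fineK// unlock; apply: integrable_fin_num => //; exact: iZ.
Qed.

Section mean_square.
Variables (m : nat) (Z : T -> 'cV[R]_m).
Hypothesis ZZ_int : integrable_mx P (fun t => Z t *m (Z t)^T).

Lemma second_moment_sym :
  (expectation_mx P (fun t => Z t *m (Z t)^T))^T =
  expectation_mx P (fun t => Z t *m (Z t)^T).
Proof.
rewrite -expectation_mx_tr.
by under eq_fun do rewrite trmx_mul trmxK.
Qed.

(** The form is the mean of the square of the scalar [g^T *m Z t]. *)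
Lemma second_moment_ge0 (g : 'cV[R]_m) :
  0 <= (g^T *m expectation_mx P (fun t => Z t *m (Z t)^T) *m g) 0 0.
Proof.
rewrite -expectation_mxMl// -expectation_mxMr; last exact: integrable_mxMl.
rewrite expectation_mxE; apply: Rintegral_ge0 => t _.
have -> : g^T *m (Z t *m (Z t)^T) *m g = (g^T *m Z t) *m (g^T *m Z t)^T.
  by rewrite trmx_mul trmxK !mulmxA.
by rewrite -sqr_mx11 sqr_ge0.
Qed.

(** The square is expanded as a 1x1 product, where the two cross terms coincide; each remaining term
    is a constant matrix times an integrable one, so linearity applies. *)
Lemma mean_square_error (D : T -> 'M[R]_1) (W : 'cV[R]_m) :
  integrable_mx P (fun t => Z t *m D t) ->
  integrable_mx P (fun t => D t *m (D t)^T) ->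
  ('E_P[(fun t => (W^T *m Z t - D t) 0 0 ^+ 2)%R])%E =
  ((W^T *m expectation_mx P (fun t => Z t *m (Z t)^T) *m W
    - (W^T *m expectation_mx P (fun t => Z t *m D t)) *+ 2) 0 0
   + expectation_mx P (fun t => D t *m (D t)^T) 0 0)%:E.
Proof.
move=> ZD_int DD_int.
(* The factor -2 is absorbed into the constant left matrix, so that [expectation_mxMl] handles the
   cross term. *)
have expand t : (W^T *m Z t - D t) *m (W^T *m Z t - D t)^T =
    W^T *m (Z t *m (Z t)^T) *m W + (- (W^T *+ 2)) *m (Z t *m D t)
    + D t *m (D t)^T.
  have DZW : D t *m (W^T *m Z t)^T = W^T *m (Z t *m D t).
    by rewrite -[LHS]trmx11 trmx_mul trmxK trmx11 mulmxA.
  have ZWD : W^T *m Z t *m (D t)^T = W^T *m (Z t *m D t).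
    by rewrite trmx11 mulmxA.
  rewrite [(_ - _)^T]linearB/= mulmxBl !mulmxBr DZW ZWD trmx_mul trmxK !mulmxA.
  by rewrite mulr2n !opprD opprK !mulmxDl !mulNmx !addrA.
under eq_fun do rewrite sqr_mx11 expand.
have i1 : integrable_mx P (fun t => W^T *m (Z t *m (Z t)^T) *m W).
  exact/integrable_mxMr/integrable_mxMl.
have i2 : integrable_mx P (fun t => (- (W^T *+ 2)) *m (Z t *m D t)).
  exact: integrable_mxMl.
have i12 := integrable_mxD i1 i2.
rewrite expectation_mx11; last exact: integrable_mxD.
rewrite !expectation_mxD// expectation_mxMr ?expectation_mxMl//.
  by rewrite mulNmx [W^T *+ 2]mulr2n mulmxDl -mulr2n [in LHS]mxE.
exact: integrable_mxMl.
Qed.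

End mean_square.
End expectation_mx.

(** A sum of squares that is at most 0 has only zero terms. *)
Lemma mulmx_tr_self_eq0 (R : realDomainType) m (r : 'cV[R]_m) :
  (r^T *m r) 0 0 <= 0 -> r = 0.
Proof.
rewrite mxE => le0; apply/matrixP => i j; rewrite ord1 mxE.
have ge0 k : true -> 0 <= r^T 0 k * r k 0 by rewrite mxE -expr2 sqr_ge0.
have /eqP : \sum_k r^T 0 k * r k 0 = 0 by apply/eqP; rewrite eq_le le0 sumr_ge0.
rewrite psumr_eq0// => /allP/(_ i (mem_index_enum i))/=.
by rewrite mxE -expr2 sqrf_eq0 => /eqP.
Qed.

Lemma minimizer_quadratic_form (R : realFieldType) m (S : 'M[R]_m)
    (b W : 'cV[R]_m) :
  S^T = S -> (forall g : 'cV[R]_m, 0 <= (g^T *m S *m g) 0 0) ->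
  S \in unitmx ->
  (forall W' : 'cV[R]_m,
     (W^T *m S *m W - (W^T *m b) *+ 2) 0 0 <=
     (W'^T *m S *m W' - (W'^T *m b) *+ 2) 0 0)
  <-> W = invmx S *m b.
Proof.
move=> S_sym S_ge0 S_unit.
have incr (V g : 'cV[R]_m) :
    ((V + g)^T *m S *m (V + g) - ((V + g)^T *m b) *+ 2) 0 0 =
    (V^T *m S *m V - (V^T *m b) *+ 2) 0 0 +
    ((g^T *m S *m g) 0 0 + (g^T *m (S *m V - b)) 0 0 *+ 2).
  (* Symmetry of [S] merges the two mixed terms into twice one of them. *)
  have VSg : V^T *m S *m g = g^T *m S *m V.
    by rewrite -[LHS]trmx11 !trmx_mul trmxK S_sym mulmxA.
  rewrite [(V + g)^T]linearD/= !mulmxDl !mulmxDr mulmxN VSg !mulmxA.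
  (* The 1x1 products become opaque, so that [ring] sees only their entries. *)
  move: (V^T *m S *m V) (g^T *m S *m V) (g^T *m S *m g) (V^T *m b) (g^T *m b).
  by move=> a1 a2 a3 a4 a5; rewrite !mxE; ring.
split=> [W_min | ->].
  suff normal : S *m W - b = 0.
    by rewrite -(subr0_eq normal) mulKmx.
  set r := S *m W - b; apply: mulmx_tr_self_eq0.
  rewrite leNgt; apply/negP => r_gt0.
  set s := (r^T *m r) 0 0 in r_gt0; set q := (r^T *m S *m r) 0 0.
  have q_ge0 : 0 <= q by exact: S_ge0.
  (* The descent step - a r would change the form by a^2 q - 2 a s < 0. *)
  pose a := s / (q + 1).
  (* The [+ 1] keeps the denominator positive even when [q = 0]. *)
  have sE : s = a * (q + 1) by rewrite /a divfK// gt_eqF// ltr_wpDl.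
  have a_gt0 : 0 < a by rewrite divr_gt0// ltr_wpDl.
  have := W_min (W + (- a) *: r); rewrite incr lerDl -/r.
  rewrite [(- a *: r)^T]linearZ/= -!scalemxAl -scalemxAr scalerA mulrNN.
  rewrite [((a * a) *: (r^T *m S *m r)) 0 0]mxE [(- a *: (r^T *m r)) 0 0]mxE.
  rewrite -/q -/s sE.
  (* Substituting [s = a * (q + 1)] makes the increment visibly negative, against minimality. *)
  have -> : a * a * q + (- a * (a * (q + 1))) *+ 2 = - (a ^+ 2 * (q + 2)).
    by ring.
  by rewrite oppr_ge0 leNgt mulr_gt0 ?exprn_gt0// ltr_wpDl.
(* At [invmx S *m b] the linear part of the increment vanishes and only the nonnegative quadratic
   part is left. *)
move=> W'; rewrite -[W' in leRHS](subrKC (invmx S *m b)) incr lerDl.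
by rewrite mulKVmx// subrr mulmx0 [X in X *+ 2]mxE mul0rn addr0 S_ge0.
Qed.

(** The equivalence gives both that the formula is a minimizer and that it is the only one. *)
Theorem proposition4p2 (R : realType) (n d c M : nat)
    (f : gcn R d c) (f_conv : conv_count f = M)
    (v : 'I_n) (y : 'I_c)
    (X : 'M[R]_(n, d)) (A : 'M[R]_n) (A_ge0 : nonneg_mx A)
    (DX : probability (borel_mx R n d) R) (DA : probability (borel_mx R n n) R)
    (DA_ge0 : {ae DA, forall E : borel_mx R n n, nonneg_mx (A - (E : 'M[R]_n))})
    (dT : measure_display) (T : measurableType dT) (P : probability T R)
    (eX : {RV P >-> borel_mx R n d}) (eA : {RV P >-> borel_mx R n n})
    (eX_law : forall B, measurable B -> distribution P eX B = DX B)
    (eA_law : forall B, measurable B -> distribution P eA B = DA B)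
    (Phi := fun t : T => phi M v X A (eX t) (eA t))
    (Del := fun t : T => (node_indic R v)^T *m delta f y X A (eX t) (eA t))
    (PhiPhi_int : integrable_mx P (fun t => Phi t *m (Phi t)^T))
    (PhiDel_int : integrable_mx P (fun t => Phi t *m Del t))
    (DelDel_int : integrable_mx P (fun t => Del t *m (Del t)^T))
    (PhiPhi_unit : expectation_mx P (fun t => Phi t *m (Phi t)^T) \in unitmx) :
  forall W : stacked R M d,
    (forall W' : stacked R M d,
       (unfaithfulness P (target f v y) (kec v W) X A eX eA
        <= unfaithfulness P (target f v y) (kec v W') X A eX eA)%E)
    <-> W = invmx (expectation_mx P (fun t => Phi t *m (Phi t)^T))
            *m expectation_mx P (fun t => Phi t *m Del t).
Proof.
have residual W t :
    kec v W X A - kec v W (X - eX t) (A - eA t)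
    - (target f v y X A - target f v y (X - eX t) (A - eA t)) =
    (W^T *m Phi t - Del t) 0 0.
  rewrite [RHS]mxE [X in _ = _ + X]mxE; congr (_ - _).
    (* Only the [W] of [W^T *m Phi t] is cut into blocks; the product then becomes a sum over hops,
       matched term by term with [kec]. *)
    rewrite -{3}(submxcolK W) tr_mxcol mul_mxrow_mxcol summxE /kec -sumrB.
    apply: eq_bigr => k _.
    rewrite [(submxcol W k)^T *m _]mulmx_tr_cVC -/(block W k).
    rewrite trmxK [in RHS]mulmxBr [in RHS]mulmxBl [RHS]mxE [X in _ = _ + X]mxE.
    by rewrite !mulmxA.
  rewrite /Del /delta mulmxBr [RHS]mxE [X in _ = _ + X]mxE /target.
  by rewrite !colE !mulmxA -!colE; congr (_ - _); rewrite [RHS]mxE.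
have unfaithfulnessE U := mean_square_error PhiPhi_int U PhiDel_int DelDel_int.
have residual_sqr U :
    unfaithfulness P (target f v y) (kec v U) X A eX eA =
    ('E_P[(fun t => (U^T *m Phi t - Del t) 0 0 ^+ 2)%R])%E.
  by congr expectation; apply/funext => t; rewrite residual.
move=> W.
(* The closed form for [W] is traded for minimality of the quadratic form. *)
rewrite -(minimizer_quadratic_form _ _ (second_moment_sym P Phi)
  (second_moment_ge0 PhiPhi_int) PhiPhi_unit).
(* Both sides are finite and share the second moment of [Del], which [lerD2r] cancels. *)
by split=> W_min W'; have := W_min W'; rewrite !residual_sqr !unfaithfulnessE lee_fin lerD2r.
Qed.
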